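(* Let $(E,d)$ be a $d$-$\sigma$-stable $(\varepsilon,\lambda)$-complete $RM$ space with base $(\Omega,\mathcal{F},P)$, let $\varepsilon\in L^0_{++}(\mathcal{F})$, and let $f:E\to\bar{L}^0(\mathcal{F})$ be proper, $\sigma$-stable, $\mathcal{T}_{\varepsilon,\lambda}$-lower semicontinuous and bounded from below. Then for any given point $x_0\in E$ satisfying $f(x_0)\le \bigwedge f(E)+\varepsilon$ and any given $\alpha\in L^0_{++}(\mathcal{F})$, there exists $z\in E$ such that the following hold: (1) $f(z)\le f(x_0)-\alpha\cdot d(z,x_0)$; (2) $d(z,x_0)\le \alpha^{-1}\cdot\varepsilon$; (3) for each $x\in E$ with $x\ne z$, one has $f(x)\ge f(z)-\alpha\cdot d(x,z)$ and $f(x)\neq f(z)-\alpha\cdot d(x,z)$.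
   Context: $(\Omega,\mathcal{F},P)$ is a probability space. $L^0(\mathcal{F})$ (resp. $\bar{L}^0(\mathcal{F})$) is the set of equivalence classes (under a.s. equality) of real-valued (resp. extended real-valued) $\mathcal{F}$-measurable random variables, ordered by $\xi\le\eta$ iff $\xi^0\le\eta^0$ a.s. for representatives $\xi^0,\eta^0$. $\bar{L}^0(\mathcal{F})$ is a complete lattice; $\bigwedge H$ and $\bigvee H$ denote infimum and supremum, and $f(E)=\{f(x):x\in E\}$. For $A\in\mathcal{F}$, ''$\xi>\eta$ on $A$'' means $\xi^0>\eta^0$ a.s. on $A$, and $\tilde{I}_A$ is the equivalence class of the characteristic function of $A$. $L^0_+(\mathcal{F})=\{\xi\in L^0(\mathcal{F}):\xi\ge 0\}$, $L^0_{++}(\mathcal{F})=\{\xi\in L^0(\mathcal{F}):\xi>0\text{ on }\Omega\}$. Products with $\tilde I_A$ use the convention $0\cdot(\pm\infty)=0$. An $RM$ (random metric) space with base $(\Omega,\mathcal{F},P)$ is a pair $(E,d)$, $E$ a nonempty set and $d:E\times E\to L^0_+(\mathcal{F})$, such that $d(p,q)=0$ iff $p=q$, $d(p,q)=d(q,p)$, and $d(p,r)\le d(p,q)+d(q,r)$. $L^0(\mathcal{F})$ is itself an $RM$ space under $|\xi-\eta|$, and $E\times L^0(\mathcal{F})$ is an $RM$ space under $d(x,y)+|r-s|$ for $(x,r),(y,s)$. A countable partition $\{A_n:n\in N\}$ of $\Omega$ to $\mathcal{F}$ is a sequence of pairwise disjoint members of $\mathcal{F}$ with union $\Omega$. $E$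 is $d$-$\sigma$-stable if for each sequence $\{x_n\}$ in $E$ and each countable partition $\{A_n\}$ of $\Omega$ to $\mathcal{F}$ there is $x\in E$ with $\tilde{I}_{A_n}\cdot d(x,x_n)=0$ for all $n$; such $x$ is unique and is denoted $\sum_{n=1}^\infty\tilde{I}_{A_n}\cdot x_n$. The $(\varepsilon,\lambda)$-uniformity on an $RM$ space $(E,d)$ has as base the sets $\{(x,y)\in E\times E: P\{\omega: d(x,y)(\omega)<\varepsilon\}>1-\lambda\}$ for real $\varepsilon>0$, $0<\lambda<1$; its topology is $\mathcal{T}_{\varepsilon,\lambda}$; $(E,d)$ is $(\varepsilon,\lambda)$-complete if it is complete in this uniformity. For $f:E\to\bar{L}^0(\mathcal{F})$: $f$ is proper if $f(x)>-\infty$ on $\Omega$ for all $x\in E$ and $\{x\in E:f(x)<+\infty\text{ on }\Omega\}\ne\emptyset$; a proper $f$ is $\mathcal{T}_{\varepsilon,\lambda}$-lower semicontinuous if $\mathrm{epi}(f)=\{(x,r)\in E\times L^0(\mathcal{F}):f(x)\le r\}$ is $\mathcal{T}_{\varepsilon,\lambda}$-closed in $E\times L^0(\mathcal{F})$; $f$ is $\sigma$-stable if $f(\sum_{n}\tilde{I}_{A_n}\cdot x_n)=\sum_{n}\tilde{I}_{A_n}\cdot f(x_n)$ for all sequences $\{x_n\}$ in $E$ and all countable partitions $\{A_n\}$ of $\Omega$ to $\mathcal{F}$; $f$ is bounded from below if there is $\eta\in L^0(\mathcal{F})$ with $f(x)\ge\eta$ for all $x\in E$. *)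

(* Defs.v *)
From HB Require Import structures.
From mathcomp Require Import all_boot all_order all_algebra.
From mathcomp Require Import all_classical all_reals all_analysis.
From mathcomp Require Import measurable_realfun lra.

Set Implicit Arguments.
Unset Strict Implicit.
Unset Printing Implicit Defensive.

Import Order.TTheory GRing.Theory Num.Theory.
Import numFieldNormedType.Exports.

Local Open Scope classical_set_scope.
Local Open Scope ring_scope.
Local Open Scope quotient_scope.

Lemma measurable_inv (R : realType) :
  measurable_fun [set: R] (fun x : R => x^-1).
Proof.
rewrite -(setUv [set (0 : R)]).
apply/(measurable_funU _ (measurable_set1 _) (measurableC (measurable_set1 _))).
split; first exact: measurable_fun_set1.
apply: open_continuous_measurable_fun; first apply/closed_openC.
  exact: closed_eq.
by move=> x /set_mem /eqP x0; exact: inv_continuous.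
Qed.

Section L0_def.
Context (d : measure_display) (T : measurableType d) (R : realType).
Variable P : probability T R.

Definition L0 : Type := {mfun_ P, T >-> R}.
Definition L0bar : Type := {mfun_ P, T >-> \bar R}.

HB.instance Definition _ := Choice.on L0.
HB.instance Definition _ := EqQuotient.on L0.
HB.instance Definition _ := Choice.on L0bar.
HB.instance Definition _ := EqQuotient.on L0bar.

Definition L0_repr (xi : L0) : T -> R := repr xi.
Coercion L0_repr : L0 >-> Funclass.
Definition L0bar_repr (X : L0bar) : T -> \bar R := repr X.
Coercion L0bar_repr : L0bar >-> Funclass.

Lemma measurable_L0 (xi : L0) : measurable_fun [set: T] (xi : T -> R).
Proof. exact: measurable_funPT. Qed.

Lemma measurable_L0bar (X : L0bar) : measurable_fun [set: T] (X : T -> \bar R).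
Proof. exact: measurable_funPT. Qed.

Definition L0_class (f : T -> R) (mf : measurable_fun [set: T] f) : L0 :=
  \pi_L0 (mfun_Sub (mem_set mf) : {mfun T >-> R}).

Definition L0bar_class (f : T -> \bar R) (mf : measurable_fun [set: T] f) :
  L0bar := \pi_L0bar (mfun_Sub (mem_set mf) : {mfun T >-> \bar R}).

Lemma L0P (xi eta : L0) : xi = eta <-> {ae P, forall w, xi w = eta w}.
Proof.
split=> [->|h]; first exact: aeW.
by rewrite -[xi]reprK -[eta]reprK; apply/eqmodP/asboolP; apply: filterS h.
Qed.

Lemma L0barP (X Y : L0bar) : X = Y <-> {ae P, forall w, X w = Y w}.
Proof.
split=> [->|h]; first exact: aeW.
by rewrite -[X]reprK -[Y]reprK; apply/eqmodP/asboolP; apply: filterS h.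
Qed.

Lemma L0_classE f (mf : measurable_fun [set: T] f) :
  {ae P, forall w, L0_class mf w = f w}.
Proof.
have : \pi_L0 (repr (L0_class mf)) = L0_class mf by exact: reprK.
by move=> /eqmodP /asboolP; apply: filterS => w /(_ I).
Qed.

Lemma L0bar_classE f (mf : measurable_fun [set: T] f) :
  {ae P, forall w, L0bar_class mf w = f w}.
Proof.
have : \pi_L0bar (repr (L0bar_class mf)) = L0bar_class mf by exact: reprK.
by move=> /eqmodP /asboolP; apply: filterS => w /(_ I).
Qed.

Definition L0_le (xi eta : L0) : bool := `[< {ae P, forall w, xi w <= eta w} >].

Lemma L0_le_refl : reflexive L0_le.
Proof. by move=> x; apply/asboolP/aeW. Qed.

Lemma L0_le_anti : antisymmetric L0_le.
Proof.
move=> x y /andP[/asboolP xy /asboolP yx]; apply/L0P.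
by apply: filterS2 xy yx => w xy yx; apply/eqP; rewrite eq_le xy.
Qed.

Lemma L0_le_trans : transitive L0_le.
Proof.
move=> y x z /asboolP xy /asboolP yz; apply/asboolP.
by apply: filterS2 xy yz => w; exact: le_trans.
Qed.

HB.instance Definition _ := Order.Le_isPOrder.Build ring_display L0
  L0_le_refl L0_le_anti L0_le_trans.

Definition L0bar_le (X Y : L0bar) : bool :=
  `[< {ae P, forall w, (X w <= Y w)%E} >].

Lemma L0bar_le_refl : reflexive L0bar_le.
Proof. by move=> x; apply/asboolP/aeW. Qed.

Lemma L0bar_le_anti : antisymmetric L0bar_le.
Proof.
move=> x y /andP[/asboolP xy /asboolP yx]; apply/L0barP.
by apply: filterS2 xy yx => w xy yx; apply/eqP; rewrite eq_le xy.
Qed.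

Lemma L0bar_le_trans : transitive L0bar_le.
Proof.
move=> y x z /asboolP xy /asboolP yz; apply/asboolP.
by apply: filterS2 xy yz => w; exact: le_trans.
Qed.

HB.instance Definition _ := Order.Le_isPOrder.Build ring_display L0bar
  L0bar_le_refl L0bar_le_anti L0bar_le_trans.

Lemma L0_leP (xi eta : L0) :
  reflect {ae P, forall w, xi w <= eta w} (xi <= eta).
Proof. exact: asboolP. Qed.

Lemma L0bar_leP (X Y : L0bar) :
  reflect {ae P, forall w, (X w <= Y w)%E} (X <= Y).
Proof. exact: asboolP. Qed.

Definition L0_cst (c : R) : L0 := L0_class (measurable_cst c).

Definition L0_add (xi eta : L0) : L0 :=
  L0_class (measurable_funD (measurable_L0 xi) (measurable_L0 eta)).

Definition L0_opp (xi : L0) : L0 := L0_class (measurable_funN (measurable_L0 xi)).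

Definition L0_mul (xi eta : L0) : L0 :=
  L0_class (measurable_funM (measurable_L0 xi) (measurable_L0 eta)).

(* Pointwise inverse, with 0^-1 = 0 as in the library. *)
Definition L0_inv (xi : L0) : L0 :=
  L0_class (measurableT_comp (@measurable_inv R) (measurable_L0 xi)).

Definition L0_abs (xi : L0) : L0 :=
  L0_class (measurableT_comp (@normr_measurable R setT) (measurable_L0 xi)).

Definition L0_indic (A : set T) (mA : measurable A) : L0 :=
  @L0_class \1_A (measurable_indic mA).

Lemma L0_cstE c : {ae P, forall w, L0_cst c w = c}.
Proof. exact: L0_classE. Qed.

Lemma L0_addE xi eta : {ae P, forall w, L0_add xi eta w = xi w + eta w}.
Proof. exact: L0_classE. Qed.

Lemma L0_oppE xi : {ae P, forall w, L0_opp xi w = - xi w}.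
Proof. exact: L0_classE. Qed.

Lemma L0_mulE xi eta : {ae P, forall w, L0_mul xi eta w = xi w * eta w}.
Proof. exact: L0_classE. Qed.

Lemma L0_addA : associative L0_add.
Proof.
move=> x y z; apply/L0P; near=> w.
rewrite (near (L0_addE x (L0_add y z)) w)// (near (L0_addE y z) w)//.
by rewrite (near (L0_addE (L0_add x y) z) w)// (near (L0_addE x y) w)// addrA.
Unshelve. all: by end_near. Qed.

Lemma L0_addC : commutative L0_add.
Proof.
move=> x y; apply/L0P; near=> w.
by rewrite (near (L0_addE x y) w)// (near (L0_addE y x) w)// addrC.
Unshelve. all: by end_near. Qed.

Lemma L0_add0 : left_id (L0_cst 0) L0_add.
Proof.
move=> x; apply/L0P; near=> w.
by rewrite (near (L0_addE (L0_cst 0) x) w)// (near (L0_cstE 0) w)// add0r.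
Unshelve. all: by end_near. Qed.

Lemma L0_addN : left_inverse (L0_cst 0) L0_opp L0_add.
Proof.
move=> x; apply/L0P; near=> w.
rewrite (near (L0_addE (L0_opp x) x) w)// (near (L0_oppE x) w)//.
by rewrite (near (L0_cstE 0) w)// addNr.
Unshelve. all: by end_near. Qed.

HB.instance Definition _ := GRing.isZmodule.Build L0
  L0_addA L0_addC L0_add0 L0_addN.

Lemma L0_mulA : associative L0_mul.
Proof.
move=> x y z; apply/L0P; near=> w.
rewrite (near (L0_mulE x (L0_mul y z)) w)// (near (L0_mulE y z) w)//.
by rewrite (near (L0_mulE (L0_mul x y) z) w)// (near (L0_mulE x y) w)// mulrA.
Unshelve. all: by end_near. Qed.

Lemma L0_mulC : commutative L0_mul.
Proof.
move=> x y; apply/L0P; near=> w.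
by rewrite (near (L0_mulE x y) w)// (near (L0_mulE y x) w)// mulrC.
Unshelve. all: by end_near. Qed.

Lemma L0_mul1 : left_id (L0_cst 1) L0_mul.
Proof.
move=> x; apply/L0P; near=> w.
by rewrite (near (L0_mulE (L0_cst 1) x) w)// (near (L0_cstE 1) w)// mul1r.
Unshelve. all: by end_near. Qed.

Lemma L0_mulD : left_distributive L0_mul L0_add.
Proof.
move=> x y z; apply/L0P; near=> w.
rewrite (near (L0_mulE (L0_add x y) z) w)// (near (L0_addE x y) w)//.
rewrite (near (L0_addE (L0_mul x z) (L0_mul y z)) w)//.
by rewrite (near (L0_mulE x z) w)// (near (L0_mulE y z) w)// mulrDl.
Unshelve. all: by end_near. Qed.

HB.instance Definition _ := GRing.Zmodule_isComPzRing.Build L0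
  L0_mulA L0_mulC L0_mul1 L0_mulD.

Lemma L00E : {ae P, forall w, (0 : L0) w = 0}.
Proof. exact: L0_cstE. Qed.

Lemma L0DE (xi eta : L0) : {ae P, forall w, (xi + eta : L0) w = xi w + eta w}.
Proof. exact: L0_addE. Qed.

Lemma L0BE (xi eta : L0) : {ae P, forall w, (xi - eta : L0) w = xi w - eta w}.
Proof.
near=> w; rewrite (near (L0DE xi (- eta)) w)//.
by congr (_ + _); exact: (near (L0_oppE eta) w).
Unshelve. all: by end_near. Qed.

Lemma L0ME (xi eta : L0) : {ae P, forall w, (xi * eta : L0) w = xi w * eta w}.
Proof. exact: L0_mulE. Qed.

Lemma L0_absE xi : {ae P, forall w, L0_abs xi w = `|xi w|}.
Proof. exact: L0_classE. Qed.

Definition L0_EFin (xi : L0) : L0bar :=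
  L0bar_class (measurableT_comp (@EFin_measurable R setT) (measurable_L0 xi)).

Definition L0bar_add (X Y : L0bar) : L0bar :=
  L0bar_class (emeasurable_funD (measurable_L0bar X) (measurable_L0bar Y)).

Definition L0bar_sub (X Y : L0bar) : L0bar :=
  L0bar_class (emeasurable_funB (measurable_L0bar X) (measurable_L0bar Y)).

Definition L0bar_cst (c : \bar R) : L0bar := L0bar_class (measurable_cst c).

(* The default value of [infimum] is only used on the empty set. *)
Definition L0bar_inf (H : set L0bar) : L0bar := infimum (L0bar_cst +oo%E) H.

Definition L0_pp : set L0 := [set xi | {ae P, forall w, 0 < xi w}].

Record countable_partition := CountablePartition {
  part_set :> nat -> set T;
  part_measurable : forall n, measurable (part_set n);
  part_disjoint : trivIset setT part_set;
  part_cover : \bigcup_n part_set n = setT }.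

Lemma glue_sumE (A : countable_partition) (Y : nat -> \bar R) n w : A n w ->
  (\sum_(k <oo) (\1_(A k) w)%:E * Y k)%E = Y n.
Proof.
move=> Anw; apply: lim_near_cst => //; exists n.+1 => // m /= nm.
rewrite big_mkord (bigD1 (Ordinal nm))//= indicE mem_set// mul1e big1 ?adde0//.
move=> i /negP ni; rewrite indicE memNset ?mul0e// => Aiw; apply: ni.
apply/eqP/val_inj => /=; apply: (@part_disjoint A) => //.
by exists w.
Qed.

Lemma measurable_glue (A : countable_partition) (Y : nat -> L0bar) :
  measurable_fun [set: T]
    (fun w => \sum_(n <oo) (\1_(A n) w)%:E * Y n w)%E.
Proof.
move=> _ B mB; rewrite setTI.
rewrite (_ : _ @^-1` _ = \bigcup_n (A n `&` (Y n @^-1` B))).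
  apply: bigcupT_measurable => n; apply: measurableI; first exact: part_measurable.
  by rewrite -[X in measurable X]setTI; exact: measurable_L0bar.
apply/seteqP; split=> [w /= Bw|w [n _ [Anw Bw]] /=].
  have : (\bigcup_n A n) w by rewrite part_cover.
  move=> [n _ Anw]; exists n => //; split=> //=.
  by rewrite -(@glue_sumE A (Y ^~ w) _ _ Anw).
by rewrite (@glue_sumE A (Y ^~ w) _ _ Anw).
Qed.

(* The sum of the \1_(A n) * Y n; [mule] is such that 0 * +oo = 0 * -oo = 0, so
   at each point of A n the sum is Y n. *)
Definition L0bar_glue (A : countable_partition) (Y : nat -> L0bar) : L0bar :=
  L0bar_class (measurable_glue A Y).

End L0_def.

Section L0_inf.
Context (d : measure_display) (T : measurableType d) (R : realType).
Variable P : probability T R.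
Local Notation L0bar := (L0bar P).

Lemma measurable_L0bar_lt (X : L0bar) q : measurable [set w | (X w < q)%E].
Proof.
have := measurable_L0bar X measurableT (emeasurable_itv `]-oo, q[).
by rewrite setTI; congr measurable; apply/seteqP; split=> w /=; rewrite in_itv.
Qed.

Lemma L0bar_countable_cover (H : set L0bar) (q : \bar R) : H !=set0 ->
  exists2 x : nat -> L0bar, (forall n, H (x n)) &
    forall X, H X -> {ae P, forall w, (X w < q)%E -> exists n, (x n w < q)%E}.
Proof.
move=> [X0 HX0].
pose U (x : nat -> L0bar) := \bigcup_n [set w | (x n w < q)%E].
have mU x : measurable (U x).
  by apply: bigcupT_measurable => n; exact: measurable_L0bar_lt.
pose S := [set P (U x) | x in [set x : nat -> L0bar | forall n, H (x n)]].
have S_fin : ereal_sup S \is a fin_num.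
  rewrite ge0_fin_numE.
    apply: (@le_lt_trans _ _ 1%E); last exact: ltry.
    by apply: ge_ereal_sup => _ [x _ <-]; exact: probability_le1.
  apply: (@le_trans _ _ (P (U (fun=> X0)))) => //.
  by apply: ereal_sup_ubound; exists (fun=> X0).
have xk k : exists x : nat -> L0bar, (forall n, H (x n)) /\
    (ereal_sup S - (k.+1%:R^-1)%:E < P (U x))%E.
  have e0 : 0 < k.+1%:R^-1 :> R by rewrite invr_gt0.
  have [_ [x Hx <-] h] := ub_ereal_sup_adherent e0 S_fin.
  by exists x.
have [x hx] := choice xk.
pose y n := if unpickle n is Some (k, m) then x k m else X0.
have Hy n : H (y n).
  by rewrite /y; case: unpickle => [[k m]|//]; exact: (hx k).1.
have supU : (ereal_sup S <= P (U y))%E.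
  apply/lee_addgt0Pr => e e0.
  have [k ke] : exists k, k.+1%:R^-1 < e.
    have [k _ h] := near_infty_natSinv_lt (PosNum e0).
    by exists k; exact: (h k (leqnn k)).
  have := (hx k).2; rewrite lteBlDr// => /ltW/le_trans; apply.
  apply: leeD; last by rewrite lee_fin ltW.
  apply: le_measure; rewrite ?inE//; try exact: mU.
  by move=> w [m _ h]; exists (pickle (k, m)) => //; rewrite /y pickleK.
exists y => // X HX.
pose z n := if n is n'.+1 then y n' else X.
have Hz : P (U z) = P (U y).
  apply/eqP; rewrite eq_le; apply/andP; split.
    apply: le_trans supU; apply: ereal_sup_ubound; exists z => // -[|n] //=.
  apply: le_measure; rewrite ?inE//; try exact: mU.
  by move=> w [n _ h]; exists n.+1.
exists (U z `\` U y); split; first exact: measurableD.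
- have sub : U y `<=` U z by move=> w [n _ h]; exists n.+1.
  transitivity (P (U z) - P (U y))%E; last by rewrite Hz subee// fin_num_measure.
  rewrite measureD//; last by rewrite ltey_eq fin_num_measure.
  by rewrite (setIidr sub).
- move=> w /= /not_implyP[Xw nw]; split; first by exists 0%N.
  by move=> [n _ h]; apply: nw; exists n.
Qed.

Lemma lte_ratr (a b : \bar R) : (a < b)%E ->
  exists q : rat, (a < (ratr q)%:E < b)%E.
Proof.
move: a b => [a||] [b||]//= => [|_|_|_].
- by rewrite lte_fin => /rat_in_itvoo[q]; rewrite in_itv/= -!lte_fin => ?; exists q.
- have /rat_in_itvoo[q] : a < a + 1 by rewrite ltrDl.
  by rewrite in_itv/= => /andP[h _]; exists q; rewrite lte_fin h ltry.
- have /rat_in_itvoo[q] : b - 1 < b by rewrite ltrBlDr ltrDl.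
  by rewrite in_itv/= => /andP[_ h]; exists q; rewrite lte_fin h ltNyr.
- by exists 0; rewrite ltNyr ltry.
Qed.

Lemma L0bar_infimums (H : set L0bar) : H !=set0 -> infimums H !=set0.
Proof.
move=> H0; have [X0 HX0] := H0.
have /choice[x hx] (q : rat) : exists x : nat -> L0bar, (forall n, H (x n)) /\
    forall X, H X -> {ae P, forall w, (X w < (ratr q)%:E)%E ->
      exists n, (x n w < (ratr q)%:E)%E}.
  by have [x ? ?] := L0bar_countable_cover (ratr q)%:E H0; exists x.
pose y n := if unpickle n is Some (q, m) then x q m else X0.
have Hy n : H (y n).
  by rewrite /y; case: unpickle => [[k m]|//]; exact: (hx k).1.
have my := measurable_fun_einfs (fun n => measurable_L0bar (y n)) 0.
have myE := L0bar_classE P my.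
exists (L0bar_class P my); split=> [X HX|Y HY].
- apply/L0bar_leP.
  have h : {ae P, forall w, forall n, if unpickle n is Some q then
      ((X : L0bar) w < (ratr q)%:E)%E -> exists n, (x q n w < (ratr q)%:E)%E else True}.
    apply/ae_foralln => n; case: unpickle => [q|]; last exact: aeW.
    exact: (hx q).2.
  apply: filterS2 myE h => w -> h; rewrite leNgt; apply/negP => /lte_ratr[q].
  move=> /andP[Xq qy]; have := h (pickle q); rewrite pickleK => /(_ Xq)[n xq].
  have := lt_trans xq qy; apply/negP; rewrite -leNgt; apply: ereal_inf_lbound.
  by exists (pickle (q, n)) => //; rewrite /y pickleK.
- apply/L0bar_leP.
  have h : {ae P, forall w, forall n, ((Y : L0bar) w <= y n w)%E}.
    by apply/ae_foralln => n; apply/L0bar_leP/HY.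
  apply: filterS2 myE h => w -> h; apply: le_ereal_inf_tmp => _ [n _ <-].
  exact: h.
Qed.

Lemma L0bar_infP (H : set L0bar) : H !=set0 -> infimums H (L0bar_inf H).
Proof.
move=> H0; rewrite /L0bar_inf /infimum; case: ifPn => [/eqP H1|_].
  by move: H0; rewrite H1 => -[].
by have [m hm] := L0bar_infimums H0; case: xgetP => // /(_ m).
Qed.

End L0_inf.

Section RM_space.
Context (d : measure_display) (T : measurableType d) (R : realType).
Variable P : probability T R.

Record RMspace := MkRMspace {
  rm_sort :> Type;
  rm_dist : rm_sort -> rm_sort -> L0 P;
  rm_nonempty : inhabited rm_sort;
  rm_dist_ge0 : forall p q, 0 <= rm_dist p q;
  rm_dist_eq0 : forall p q, rm_dist p q = 0 <-> p = q;
  rm_dist_sym : forall p q, rm_dist p q = rm_dist q p;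
  rm_dist_triangle : forall p q r, rm_dist p r <= rm_dist p q + rm_dist q r }.

Arguments rm_dist {E} p q : rename.

Section uniformity.
Variable E : RMspace.

HB.instance Definition _ := gen_eqMixin (rm_sort E).
HB.instance Definition _ := gen_choiceMixin (rm_sort E).

Definition el_basic (e l : R) : set (E * E) :=
  [set xy | ((1 - l)%:E < P [set w | (rm_dist xy.1 xy.2 w < e)%R])%E].

Definition el_entourage : set_system (E * E) :=
  filter_from [set el : R * R | 0 < el.1 /\ 0 < el.2 < 1]
    (fun el => el_basic el.1 el.2).

Lemma measurable_rm_dist_lt (x y : E) e : measurable [set w | rm_dist x y w < e].
Proof.
have := measurable_L0 (rm_dist x y) measurableT
  (measurable_itv `]-oo, e[).
by rewrite setTI; congr measurable; apply/seteqP; split=> w /=; rewrite in_itv.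
Qed.

Lemma el_basic_sub e e' l l' : e <= e' -> l <= l' ->
  el_basic e l `<=` el_basic e' l'.
Proof.
move=> ee ll xy; rewrite /el_basic/= => h.
apply: (@le_lt_trans _ _ (1 - l)%:E); first by rewrite lee_fin lerB.
apply: (lt_le_trans h); apply: le_measure; rewrite ?inE;
  try exact: measurable_rm_dist_lt.
by move=> w /= /lt_le_trans; exact.
Qed.

Lemma el_basicP e l xy :
  el_basic e l xy <-> (P [set w | (e <= rm_dist xy.1 xy.2 w)%R] < l%:E)%E.
Proof.
have -> : [set w | (e <= rm_dist xy.1 xy.2 w)%R] =
    ~` [set w | rm_dist xy.1 xy.2 w < e].
  by apply/seteqP; split=> w /=; rewrite leNgt => /negP.
rewrite probability_setC; last exact: measurable_rm_dist_lt.
rewrite /el_basic /= -(fineK (fin_num_measure P _ (measurable_rm_dist_lt _ _ _))).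
by rewrite -EFinB !lte_fin; split; lra.
Qed.

Lemma measurable_rm_dist_ge (x y : E) e : measurable [set w | e <= rm_dist x y w].
Proof.
have -> : [set w | e <= rm_dist x y w] =
    ~` [set w | rm_dist x y w < e].
  by apply/seteqP; split=> w /=; rewrite leNgt => /negP.
exact/measurableC/measurable_rm_dist_lt.
Qed.

Lemma le_measure_ae (A B : set T) : measurable A -> measurable B ->
  {ae P, forall w, A w -> B w} -> (P A <= P B)%E.
Proof.
move=> mA mB [N [mN N0 AB]].
have -> : P B = (P B + P N)%E by rewrite N0 adde0.
apply: (le_trans _ (measureU2 P mB mN)).
apply: le_measure; rewrite ?inE//; first exact: measurableU.
by move=> w Aw; apply: contrapT => /not_orP[Bw Nw]; apply: Nw; apply: AB => /(_ Aw).
Qed.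

Lemma el_entourage_filter : Filter el_entourage.
Proof.
apply: filter_from_filter.
  by exists (1, 2^-1); rewrite /=; split; lra.
move=> [e l] [e' l'] /= [e0 l01] [e0' l01'].
exists (Num.min e e', Num.min l l').
  by rewrite /= /Num.min; split; do !case: ifP => //.
by move=> xy /= h; split; apply: el_basic_sub h; rewrite ge_min lexx ?orbT.
Qed.

Local Open Scope relation_scope.

Lemma el_entourage_diagonal A : el_entourage A -> diagonal `<=` A.
Proof.
move=> [[e l] /= [e0 /andP[l0 l1]] sA] [x y] /= xy; apply/sA/el_basicP => /=.
apply: (@le_lt_trans _ _ (P set0)); last by rewrite measure0 lte_fin.
apply: le_measure_ae => //; first exact: measurable_rm_dist_ge.
have /rm_dist_eq0 -> : x = y by [].
by apply: filterS (L00E P) => w w0 /=; rewrite w0 leNgt e0.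
Qed.

Lemma el_entourage_inv A : el_entourage A -> el_entourage A^-1.
Proof.
move=> [el el0 sA]; exists el => // -[x y] /= h; apply: sA.
by rewrite /el_basic /= rm_dist_sym.
Qed.

Lemma el_entourage_split A : el_entourage A ->
  exists2 B, el_entourage B & B \; B `<=` A.
Proof.
move=> [[e l] /= [e0 /andP[l0 l1]] sA].
exists (el_basic (e / 2) (l / 2)).
  by exists (e / 2, l / 2) => //=; split; lra.
move=> [x z] [y /el_basicP/= xy /el_basicP/= yz]; apply/sA/el_basicP => /=.
apply: (@le_lt_trans _ _ (P ([set w | e / 2 <= rm_dist x y w] `|`
    [set w | e / 2 <= rm_dist y z w]))).
  apply: le_measure_ae; first exact: measurable_rm_dist_ge.
    by apply: measurableU; exact: measurable_rm_dist_ge.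
  have /L0_leP := rm_dist_triangle x y z.
  apply: filterS2 (L0DE (rm_dist x y) (rm_dist y z)) => w -> /= h1 h2.
  by case: (leP (e / 2) (rm_dist x y w)) => h3; [left|right => /=; lra].
apply: (le_lt_trans (measureU2 P _ _)); [exact: measurable_rm_dist_ge|exact: measurable_rm_dist_ge|].
by rewrite [X in (_ < X%:E)%E](splitr l) EFinD lteD.
Qed.

HB.instance Definition _ := isUniform.Build (rm_sort E)
  el_entourage_filter el_entourage_diagonal el_entourage_inv el_entourage_split.

End uniformity.

Definition rm_closed (E : RMspace) (A : set E) : Prop := closed A.

(* The library's [completeType] without the choice of a base point. *)
Definition el_complete (E : RMspace) : Prop :=
  forall F : set_system E, ProperFilter F -> cauchy F -> exists x : E, F --> x.

Definition L0_dist (xi eta : L0 P) : L0 P := L0_abs (xi - eta).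

Lemma L0_distE xi eta : {ae P, forall w, L0_dist xi eta w = `|xi w - eta w|}.
Proof.
near=> w; rewrite (near (L0_absE (xi - eta)) w)//.
by rewrite (near (L0BE xi eta) w).
Unshelve. all: by end_near. Qed.

Lemma L0_dist_ge0 xi eta : 0 <= L0_dist xi eta.
Proof.
apply/L0_leP; near=> w.
by rewrite (near (L0_distE xi eta) w)// (near (L00E P) w).
Unshelve. all: by end_near. Qed.

Lemma L0_dist_eq0 xi eta : L0_dist xi eta = 0 <-> xi = eta.
Proof.
split=> [/L0P h|->]; apply/L0P; near=> w.
  have := near h w; rewrite (near (L0_distE xi eta) w)// (near (L00E P) w)//.
  by move=> /(_ _)/normr0_eq0/subr0_eq; exact.
by rewrite (near (L0_distE eta eta) w)// (near (L00E P) w)// subrr normr0.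
Unshelve. all: by end_near. Qed.

Lemma L0_dist_sym xi eta : L0_dist xi eta = L0_dist eta xi.
Proof.
apply/L0P; near=> w.
by rewrite (near (L0_distE xi eta) w)// (near (L0_distE eta xi) w)// distrC.
Unshelve. all: by end_near. Qed.

Lemma L0_dist_triangle xi eta zeta :
  L0_dist xi zeta <= L0_dist xi eta + L0_dist eta zeta.
Proof.
apply/L0_leP; near=> w.
rewrite (near (L0DE (L0_dist xi eta) (L0_dist eta zeta)) w)//.
rewrite (near (L0_distE xi eta) w)// (near (L0_distE eta zeta) w)//.
by rewrite (near (L0_distE xi zeta) w)// ler_distD.
Unshelve. all: by end_near. Qed.

Definition L0_RM : RMspace := MkRMspace (inhabits 0)
  L0_dist_ge0 L0_dist_eq0 L0_dist_sym L0_dist_triangle.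

Section product.
Variables E F : RMspace.

Definition prod_dist (p q : E * F) : L0 P :=
  rm_dist p.1 q.1 + rm_dist p.2 q.2.

Lemma prod_distE p q : {ae P, forall w,
  prod_dist p q w = rm_dist p.1 q.1 w + rm_dist p.2 q.2 w}.
Proof. exact: L0DE. Qed.

Lemma prod_nonempty : inhabited (E * F).
Proof. by case: (rm_nonempty E) => x; case: (rm_nonempty F) => y. Qed.

Lemma rm_dist_ge0_ae (G : RMspace) (x y : G) : {ae P, forall w, 0 <= rm_dist x y w}.
Proof.
have /L0_leP := rm_dist_ge0 x y.
by apply: filterS2 (L00E P) => w ->.
Qed.

Lemma prod_dist_ge0 p q : 0 <= prod_dist p q.
Proof.
apply/L0_leP; near=> w.
rewrite (near (prod_distE p q) w)// (near (L00E P) w)// addr_ge0//.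
  by apply: (near (rm_dist_ge0_ae p.1 q.1) w).
by apply: (near (rm_dist_ge0_ae p.2 q.2) w).
Unshelve. all: by end_near. Qed.

Lemma prod_dist_eq0 p q : prod_dist p q = 0 <-> p = q.
Proof.
split=> [/L0P h|->]; last first.
  rewrite /prod_dist.
  have /rm_dist_eq0 -> : q.1 = q.1 by [].
  have /rm_dist_eq0 -> : q.2 = q.2 by [].
  by rewrite addr0.
have h' : {ae P, forall w, rm_dist p.1 q.1 w = 0 /\ rm_dist p.2 q.2 w = 0}.
  near=> w.
  have h0 : prod_dist p q w = (0 : L0 P) w by apply: (near h w).
  have h1 : 0 <= rm_dist p.1 q.1 w by apply: (near (rm_dist_ge0_ae p.1 q.1) w).
  have h2 : 0 <= rm_dist p.2 q.2 w by apply: (near (rm_dist_ge0_ae p.2 q.2) w).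
  move: h0; rewrite (near (prod_distE p q) w)// (near (L00E P) w)// => h0.
  by split; lra.
rewrite [p]surjective_pairing [q]surjective_pairing; congr pair.
  by apply/rm_dist_eq0/L0P; apply: filterS2 (L00E P) h' => w -> [].
by apply/rm_dist_eq0/L0P; apply: filterS2 (L00E P) h' => w -> [].
Unshelve. all: by end_near. Qed.

Lemma prod_dist_sym p q : prod_dist p q = prod_dist q p.
Proof. by rewrite /prod_dist rm_dist_sym (rm_dist_sym p.2). Qed.

Lemma prod_dist_triangle p q r :
  prod_dist p r <= prod_dist p q + prod_dist q r.
Proof.
have /L0_leP h1 := rm_dist_triangle p.1 q.1 r.1.
have /L0_leP h2 := rm_dist_triangle p.2 q.2 r.2.
apply/L0_leP; near=> w.
rewrite (near (L0DE (prod_dist p q) (prod_dist q r)) w)//.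
rewrite (near (prod_distE p q) w)// (near (prod_distE q r) w)//.
rewrite (near (prod_distE p r) w)// addrACA lerD//.
  by rewrite -(near (L0DE (rm_dist p.1 q.1) (rm_dist q.1 r.1)) w)// (near h1 w).
by rewrite -(near (L0DE (rm_dist p.2 q.2) (rm_dist q.2 r.2)) w)// (near h2 w).
Unshelve. all: by end_near. Qed.

Definition prod_RM : RMspace := MkRMspace prod_nonempty
  prod_dist_ge0 prod_dist_eq0 prod_dist_sym prod_dist_triangle.

End product.

Section functions.
Variable E : RMspace.

(* x is the sum of the \1_(A n) * x_ n. *)
Definition is_glue (A : countable_partition T) (x_ : nat -> E) (x : E) : Prop :=
  forall n, L0_indic P (part_measurable A n) * rm_dist x (x_ n) = 0.

Definition d_sigma_stable : Prop :=
  forall (A : countable_partition T) (x_ : nat -> E), exists x, is_glue A x_ x.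

Variable f : E -> L0bar P.

Definition proper_fun : Prop :=
  (forall x, {ae P, forall w, (-oo < f x w)%E}) /\
  exists x, {ae P, forall w, (f x w < +oo)%E}.

Definition epi : set (prod_RM E L0_RM) := [set xr | f xr.1 <= L0_EFin xr.2].

Definition el_lsc : Prop := rm_closed epi.

Definition sigma_stable_fun : Prop :=
  forall (A : countable_partition T) (x_ : nat -> E) (x : E),
    is_glue A x_ x -> f x = L0bar_glue A (f \o x_).

Definition bounded_from_below : Prop :=
  exists eta : L0 P, forall x, L0_EFin eta <= f x.

End functions.

End RM_space.

Arguments rm_dist {d T R P E} p q : rename.

(* Main.v *)
Require Import Defs.
From mathcomp Require Import all_boot all_order all_algebra.
From mathcomp Require Import all_classical all_reals all_analysis.
From mathcomp Require Import measurable_realfun lra.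

Import Order.TTheory GRing.Theory Num.Theory.
Import numFieldNormedType.Exports.
Local Open Scope classical_set_scope.
Local Open Scope ring_scope.

(** Fix [alpha] and say that [y] is below [x] when
    [f y + alpha d(y, x) <= f x] almost surely. This is a preorder, and the
    point wanted is a [z] below [x0] that has nothing but itself below it.

    The classical construction works once infima of [f] can be nearly attained
    by a single point. The essential infimum of [f] over the points below [x]
    is the pointwise infimum along some sequence [v] of such points
    ([L0bar_inf_sequence]). On the event where [v k] is the first term within
    [c] of that infimum use [v k]: sigma-stability glues these choices into one
    point [y] below [x] with [f y <= f u + c] for every [u] below [x]
    ([ekeland_near_inf]). The tolerance [c] may be any positive random variable.
    Taking [c = alpha b / (n+1)] with [b = 1 / (1 + |alpha|)] gives a decreasing
    sequence [x n] such that every [u] below [x n.+1] satisfies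
    [d(u, x n.+1) <= b / (n+1)] almost surely, hence both [d(u, x n.+1)] and
    [alpha d(u, x n.+1)] are at most [1 / (n+1)] outside a null set. The
    sequence is therefore Cauchy uniformly in the sample point, and so in
    probability. Its limit [z] obeys the same bounds, lower semicontinuity puts
    [z] below every [x n], and a point below [z] is within [2 / (n+1)] of [z]
    for all [n], so it is [z] ([ekeland_minimal_point]).

    Minimality of [z] compares it with points below [z] on the whole sample
    space, whereas the last conclusion is an inequality for every [x]. To get
    it, glue [x] on the event where [f x + alpha d(x, z) < f z] with [z]
    elsewhere: the result is below [z], hence equal to [z], so that [d(x, z) = 0]
    and [f x = f z] on that event, which must then be null
    ([ekeland_minimal_ae_ge]). *)

(** * Almost sure bounds on the random distance *)

Section RandomMetric.
Context {d : measure_display} {T : measurableType d} {R : realType}.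
Context {P : probability T R}.
Implicit Type E : RMspace P.

Lemma L0_EFinE (xi : L0 P) : {ae P, forall w, L0_EFin xi w = (xi w)%:E}.
Proof. exact: L0bar_classE. Qed.

Lemma rm_distxx_ae E (x : E) : {ae P, forall w, rm_dist x x w = 0}.
Proof.
have /rm_dist_eq0 -> : x = x by [].
exact: L00E.
Qed.

Lemma rm_dist_triangle_ae E (x y z : E) :
  {ae P, forall w, rm_dist x z w <= rm_dist x y w + rm_dist y z w}.
Proof.
have /L0_leP := rm_dist_triangle x y z.
by apply: filterS2 (L0DE (rm_dist x y) (rm_dist y z)) => w ->.
Qed.

Lemma rm_dist_eq0_ae E (x y : E) : {ae P, forall w, rm_dist x y w = 0} -> x = y.
Proof.
move=> xy; apply/rm_dist_eq0/L0P.
by apply: filterS2 (L00E P) xy => w -> ->.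
Qed.

(** For a fixed [u]: the exceptional null set may depend on it. *)
Lemma rm_dist_congr_ae E (x y u : E) :
  {ae P, forall w, rm_dist x y w = 0 -> rm_dist x u w = rm_dist y u w}.
Proof.
have := rm_dist_triangle_ae _ x y u.
have := rm_dist_triangle_ae _ y x u.
rewrite (rm_dist_sym y x); apply: filterS2 => w h1 h2 xy0.
by apply/eqP; rewrite eq_le; apply/andP; split; lra.
Qed.

(** Almost surely uniform approximation implies approximation in probability,
    which is all that closedness requires; this avoids sequences converging in
    probability when using lower semicontinuity. *)
Lemma rm_closed_ae_approx E (A : set E) (p : E) : rm_closed A ->
  (forall e : R, 0 < e ->
    exists2 q, A q & {ae P, forall w, rm_dist p q w <= e}) -> A p.
Proof.
move=> clA apx; apply: clA => B /nbhsP[V [[e l] /= [e0 /andP[l0 l1]] sV] sB].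
have e20 : 0 < e / 2 by rewrite divr_gt0.
have [q Aq pq] := apx _ e20.
exists q; split => //; apply: sB; apply/mem_set/sV/el_basicP => /=.
apply: (@le_lt_trans _ _ (P set0)); last by rewrite measure0 lte_fin.
apply: le_measure_ae => //; first exact: measurable_rm_dist_ge.
by apply: filterS pq => w pq /= ?; lra.
Qed.

(** Closed balls of random radius [u] are closed: by the triangle inequality
    the event [u + e <= d(z, y)] is almost surely contained in
    [e <= d(z, x n)], whose probability tends to 0. *)
Lemma rm_dist_limit_ae_le E (x : nat -> E) (z y : E) (u : T -> R) :
  measurable_fun setT u -> x n @[n --> \oo] --> z ->
  (\forall n \near \oo, {ae P, forall w, rm_dist (x n) y w <= u w}) ->
  {ae P, forall w, rm_dist z y w <= u w}.
Proof.
move=> mu /cvg_app_entourageP xz xu.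
have main (k : nat) : {ae P, forall w, rm_dist z y w < u w + k.+1%:R^-1}.
  set e : R := k.+1%:R^-1.
  have e0 : 0 < e by rewrite invr_gt0.
  pose N := [set w | u w + e <= rm_dist z y w].
  have mN : measurable N.
    have := measurable_lee measurableT (f := EFin \o (fun w => u w + e))
      (g := EFin \o rm_dist z y).
    rewrite setTI; apply; apply/measurable_EFinP; last exact: measurable_L0.
    exact: measurable_funD.
  exists N; split=> //; last by move=> w /= /negP; rewrite -leNgt.
  apply/eqP; rewrite eq_le measure_ge0 andbT; apply/lee_addgt0Pr => l' l'0.
  rewrite add0e.
  pose l := Num.min l' 2^-1.
  have l01 : 0 < l < 1.
    rewrite /l lt_min l'0 /= gt_min; apply/andP; split; first by lra.
    by apply/orP; right; lra.
  have ent : entourage (el_basic (E := E) e l) by exists (e, l).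
  have [n [/el_basicP/= zn un]] : exists n, el_basic (E := E) e l (z, x n) /\
      {ae P, forall w, rm_dist (x n) y w <= u w}.
    have [n _ h] := filterI (xz _ ent) xu; exists n; exact: (h n (leqnn n)).
  apply: (@le_trans _ _ l%:E); last by rewrite lee_fin ge_min lexx.
  apply: ltW; apply: le_lt_trans zn; apply: le_measure_ae => //.
    exact: measurable_rm_dist_ge.
  apply: filterS2 un (rm_dist_triangle_ae _ z (x n) y) => w h1 h2.
  by rewrite /N /= => ?; lra.
apply: filterS (ae_foralln main) => w h; rewrite leNgt; apply/negP => uz.
have dz : 0 < rm_dist z y w - u w by rewrite subr_gt0.
have [k _ /(_ k (leqnn k)) hk] := near_infty_natSinv_lt (PosNum dz).
have {}hk : k.+1%:R^-1 < rm_dist z y w - u w := hk.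
by move: hk; rewrite ltrBrDl => /(lt_trans (h k)); rewrite ltxx.
Qed.

Lemma el_complete_ae_cauchy E (x : nat -> E) (e : nat -> R) :
  el_complete E -> e n @[n --> \oo] --> 0 ->
  (forall n m, (n <= m)%N -> {ae P, forall w, rm_dist (x m) (x n) w <= e n}) ->
  exists z : E, x n @[n --> \oo] --> z.
Proof.
move=> E_complete e0 xe.
apply: (E_complete (x @ \oo)) => A /= /entourage_split_ex [B eB sB].
have [[r l] /= [r0 /andP[l0 l1]] sV] := entourage_invI eB.
have [n _ en] : \forall n \near \oo, e n < r.
  by apply: cvgr_lt e0 _ r0.
have xV m : (n <= m)%N -> el_basic (E := E) r l (x m, x n).
  move=> nm; apply/el_basicP => /=.
  apply: (@le_lt_trans _ _ (P set0)); last by rewrite measure0 lte_fin.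
  apply: le_measure_ae => //; first exact: measurable_rm_dist_ge.
  by apply: filterS (xe _ _ nm) => w h /=; have /= := en n (leqnn n) => ? ?; lra.
pose tail := [set x m | m in [set m | (n <= m)%N]].
exists (tail, tail) => /=.
  by split; exists n => // m /= nm; exists m.
move=> [_ _] /= [[m nm <-] [k nk <-]]; apply: sB; exists (x n).
  by have [] := sV _ (xV _ nm).
by have [] := sV _ (xV _ nk).
Qed.

(** * Gluing along covers and countable essential infima *)

(** Stability for covers in place of partitions, which suits the applications
    below, where the events come from inequalities and overlap. The comparison
    with [u] is stated for one [u] at a time since null sets cannot be chosen
    uniformly in [u]. *)
Lemma glue_cover E (f : E -> L0bar P) (F : nat -> set T) (x : nat -> E) :
  d_sigma_stable E -> sigma_stable_fun f ->
  (forall k, measurable (F k)) -> \bigcup_k F k = setT ->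
  exists y, forall u, {ae P, forall w, exists k,
    [/\ F k w, f y w = f (x k) w & rm_dist y u w = rm_dist (x k) u w]}.
Proof.
move=> E_stable f_stable mF cF.
have cA : \bigcup_k seqDU F k = setT by rewrite -seqDU_bigcup_eq.
pose A := CountablePartition (seqDU_measurable mF) (@trivIset_seqDU _ F) cA.
have [y yA] := E_stable A x; exists y => u.
have dy : {ae P, forall w, forall k, A k w -> rm_dist y u w = rm_dist (x k) u w}.
  apply/ae_foralln => k; have /L0P h := yA k.
  near=> w => Akw.
  apply: (near (rm_dist_congr_ae _ y (x k) u) w) => //.
  have := near h w; rewrite (near (L00E P) w)// (near (L0ME _ _) w)//.
  by rewrite (near (L0_classE P (measurable_indic (part_measurable A k))) w)//
    indicE mem_set// mul1r; apply.
have fy : {ae P, forall w, forall k, A k w -> f y w = f (x k) w}.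
  rewrite (f_stable _ _ _ yA).
  apply: filterS (L0bar_classE P (measurable_glue A (f \o x))) => w -> k Akw.
  exact: (@glue_sumE _ _ _ A (fun k => f (x k) w)).
apply: filterS2 dy fy => w h1 h2.
have [k _ Akw] : (\bigcup_k A k) w by rewrite (part_cover A).
exists k; split; [exact: subset_seqDU Akw|exact: h2|exact: h1].
Unshelve. all: by end_near. Qed.

(** The pointwise infimum of a countable subfamily is an essential lower bound of
    the whole family: if [X w] were smaller, a rational [q] would separate them,
    and for each of the countably many [q] a sequence of [H] almost surely goes
    below [q] wherever [X] does. *)
Lemma L0bar_inf_sequence (H : set (L0bar P)) : H !=set0 ->
  exists2 y : nat -> L0bar P, (forall n, H (y n)) &
    forall X, H X -> {ae P, forall w, (ereal_inf (range (y ^~ w)) <= X w)%E}.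
Proof.
move=> H0; have [X0 HX0] := H0.
have /choice[x hx] (q : rat) : exists x : nat -> L0bar P, (forall n, H (x n)) /\
    forall X, H X -> {ae P, forall w, (X w < (ratr q)%:E)%E ->
      exists n, (x n w < (ratr q)%:E)%E}.
  by have [x ? ?] := L0bar_countable_cover (ratr q)%:E H0; exists x.
exists (fun n => if unpickle n is Some (q, m) then x q m else X0) => [n|X HX].
  by case: unpickle => [[q m]|//]; exact: (hx q).1.
have h (n : nat) : {ae P, forall w, if unpickle n is Some q then
    (X w < (ratr q)%:E)%E -> exists m, (x q m w < (ratr q)%:E)%E else True}.
  case: unpickle => [q|]; last exact: aeW.
  exact: (hx q).2.
apply: filterS (ae_foralln h) => w {}h; rewrite leNgt; apply/negP => /lte_ratr[q].
move=> /andP[Xq]; apply/negP; rewrite -leNgt.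
have := h (pickle q); rewrite pickleK => /(_ Xq)[m xq].
apply: le_trans (ltW xq); apply: ereal_inf_lbound.
by exists (pickle (q, m)) => //; rewrite pickleK.
Qed.

(** * The random Ekeland preorder *)

Section Ekeland.
Context {E : RMspace P} (f : E -> L0bar P) (alpha : L0 P).

Definition ekeland_le (y x : E) : Prop :=
  {ae P, forall w, (f y w + (alpha w * rm_dist y x w)%:E <= f x w)%E}.

Context (alpha_pp : L0_pp alpha).

Lemma ekeland_le_refl x : ekeland_le x x.
Proof.
by apply: filterS (rm_distxx_ae E x) => w ->; rewrite mulr0 adde0.
Qed.

Lemma ekeland_le_value y x : ekeland_le y x -> {ae P, forall w, (f y w <= f x w)%E}.
Proof.
move=> yx; near=> w; apply: (@le_trans _ _ (f y w + (alpha w * rm_dist y x w)%:E)%E).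
  rewrite leeDl// lee_fin mulr_ge0//; first by rewrite ltW//; exact: (near alpha_pp w).
  exact: (near (rm_dist_ge0_ae y x) w).
exact: (near yx w).
Unshelve. all: by end_near. Qed.

Lemma ekeland_le_trans z y x : ekeland_le z y -> ekeland_le y x -> ekeland_le z x.
Proof.
move=> zy yx; near=> w; apply: (le_trans _ (near yx w _)) => //.
apply: (@le_trans _ _
    (f z w + (alpha w * rm_dist z y w)%:E + (alpha w * rm_dist y x w)%:E)%E).
  rewrite -addeA leeD2l// -EFinD lee_fin -mulrDr ler_wpM2l//.
    by rewrite ltW//; exact: (near alpha_pp w).
  exact: (near (rm_dist_triangle_ae E z y x) w).
by rewrite leeD2r//; exact: (near zy w).
Unshelve. all: by end_near. Qed.

Context (E_stable : d_sigma_stable E) (f_stable : sigma_stable_fun f).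
Context (f_bounded : bounded_from_below f).

Lemma bounded_from_below_ae x : {ae P, forall w, (-oo < f x w)%E}.
Proof.
have [eta /(_ x)/L0bar_leP h] := f_bounded.
apply: filterS2 h (L0_EFinE eta) => w /[swap] -> /=; apply: lt_le_trans.
exact: ltNyr.
Qed.

(** Take a sequence below [x] along which [f] has the essential infimum [g]. Since
    [g > -oo] almost surely, some term is within [c] of [g] at almost every
    sample point, and gluing selects such a term at each of them. The result is
    still below [x] because that condition is checked sample point by sample
    point. *)
Lemma ekeland_near_inf (x : E) (c : T -> R) :
  measurable_fun setT c -> {ae P, forall w, 0 < c w} ->
  exists2 y, ekeland_le y x &
    forall u, ekeland_le u x -> {ae P, forall w, (f y w <= f u w + (c w)%:E)%E}.
Proof.
move=> mc c0.
pose H := f @` [set u | ekeland_le u x].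
have [X HX infX] : exists2 X : nat -> L0bar P, (forall n, H (X n)) &
    forall Y, H Y -> {ae P, forall w, (ereal_inf (range (X ^~ w)) <= Y w)%E}.
  by apply: L0bar_inf_sequence; exists (f x), x => //; exact: ekeland_le_refl.
have /choice[v hv] (n : nat) : exists u, ekeland_le u x /\ f u = X n.
  by have [u] := HX n; exists u.
pose g w := ereal_inf (range (fun n => f (v n) w)).
have mg : measurable_fun setT g.
  rewrite (_ : g = fun w => einfs (fun n => f (v n) w) 0%N).
    exact: (measurable_fun_einfs (fun n => measurable_L0bar (f (v n))) 0).
  apply/funext => w; rewrite /g /einfs /=; congr ereal_inf.
  by apply/seteqP; split=> [_ [n _ <-]|_ [n _ <-]]; exists n.
pose B k := [set w | (f (v k) w <= g w + (c w)%:E)%E].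
have mB k : measurable (B k).
  rewrite -[B k]setTI; apply: measurable_lee => //.
  by apply: emeasurable_funD => //; exact/measurable_EFinP.
(* The first event completes the [B k] to a cover of the whole space; it is null
   by [gB]. *)
pose F k := if k is k'.+1 then B k' else ~` \bigcup_k B k.
have mF k : measurable (F k).
  case: k => [|k]; last exact: mB.
  by apply: measurableC; exact: bigcupT_measurable.
have cF : \bigcup_k F k = setT.
  apply/seteqP; split=> // w _; have [[k _ Bk]|nB] := pselect ((\bigcup_k B k) w).
    by exists k.+1.
  by exists 0%N.
have [y hy] := glue_cover E f F (fun k => v k.-1) E_stable f_stable mF cF.
have gB : {ae P, forall w, (\bigcup_k B k) w}.
  have [eta heta] := f_bounded.
  have hv' (n : nat) : {ae P, forall w, ((eta w)%:E <= f (v n) w)%E}.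
    have /L0bar_leP := heta (v n).
    by apply: filterS2 (L0_EFinE eta) => w ->.
  apply: filterS2 (ae_foralln hv') c0 => w lbw c0w.
  have etag : ((eta w)%:E <= g w)%E by apply: le_ereal_inf_tmp => _ [n _ <-].
  have [gfin|goo] := ltP (g w) +oo%E; last first.
    exists 0%N => //; rewrite /B /=; move: goo; rewrite leye_eq => /eqP ->.
    by rewrite addye// leey.
  have gf : g w \is a fin_num.
    by rewrite fin_numE gt_eqF ?lt_eqF// (lt_le_trans _ etag)// ltNyr.
  have : (g w < g w + (c w)%:E)%E by rewrite lteDl// lte_fin.
  by move=> /ereal_inf_lt[_ [k _ <-] h]; exists k => //; exact: ltW.
exists y => [|u ux].
  have vx : {ae P, forall w, forall k,
      (f (v k) w + (alpha w * rm_dist (v k) x w)%:E <= f x w)%E}.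
    by apply/ae_foralln => k; exact: (hv k).1.
  by apply: filterS2 (hy x) vx => w [k [_ -> ->]].
have Xu : {ae P, forall w, (g w <= f u w)%E}.
  have : H (f u) by exists u.
  move=> /infX; apply: filterS => w; rewrite /g.
  by under [in X in _ -> X]eq_fun do rewrite (hv _).2.
near=> w.
have [k [Fk -> _]] : exists k, [/\ F k w, f y w = f (v k.-1) w &
  rm_dist y u w = rm_dist (v k.-1) u w] by exact: (near (hy u) w).
case: k Fk => [|k] /= Fk; first by case: Fk; exact: (near gB w).
by apply: (le_trans Fk); rewrite leeD2r//; exact: (near Xu w).
Unshelve. all: by end_near. Qed.

(** * Existence of a minimal point *)

Lemma lsc_ae_le_limit (z : E) (r : L0 P) : el_lsc f ->
  (forall e : R, 0 < e -> exists y, {ae P, forall w, rm_dist z y w <= e} /\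
    {ae P, forall w, (f y w <= (r w + e)%:E)%E}) ->
  {ae P, forall w, (f z w <= (r w)%:E)%E}.
Proof.
move=> f_lsc apx.
suff /L0bar_leP h : epi f (z, r).
  by apply: filterS2 h (L0_EFinE r) => w + <-.
apply: (@rm_closed_ae_approx (prod_RM E (L0_RM P)) (epi f) (z, r) f_lsc) => e e0.
have e20 : 0 < e / 2 by rewrite divr_gt0.
have [y [zy fy]] := apx _ e20.
exists (y, r + L0_cst P (e / 2)) => /=.
  apply/L0bar_leP; near=> w.
  rewrite (near (L0_EFinE (r + L0_cst P (e / 2))) w)//=.
  rewrite (near (L0DE r (L0_cst P (e / 2))) w)// (near (L0_cstE P (e / 2)) w)//.
  exact: (near fy w).
near=> w.
have := near (@prod_distE _ _ _ _ E (L0_RM P) (z, r) (y, r + L0_cst P (e / 2))) w.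
move=> /(_ _)/= ->//.
rewrite (near (L0_distE r (r + L0_cst P (e / 2))) w)//.
rewrite (near (L0DE r (L0_cst P (e / 2))) w)// (near (L0_cstE P (e / 2)) w)//.
rewrite opprD addrA subrr add0r normrN (gtr0_norm e20) [leRHS](splitr e) lerD2r.
exact: (near zy w).
Unshelve. all: by end_near. Qed.

(** Below a near-minimizer there is little room, since [alpha d(u, y)] is at most
    [f y - f u]. Near-minimizers chosen successively, each below the previous
    one, therefore have shrinking sets of points below them, all of which
    contain the limit. Finiteness of [f x0] makes these differences
    meaningful. *)
Lemma ekeland_minimal_point (x0 : E) : el_complete E -> el_lsc f ->
  {ae P, forall w, (f x0 w < +oo)%E} ->
  exists2 z, ekeland_le z x0 & forall y, ekeland_le y z -> y = z.
Proof.
move=> E_complete f_lsc fx0.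
(* With this factor both [b] and [alpha * b] are at most 1, so that one tolerance
   controls the distance and its product with [alpha]. *)
pose b w := (1 + `|alpha w|)^-1.
have mb : measurable_fun setT b.
  apply: measurableT_comp; first exact: measurable_inv.
  by apply: measurable_funD => //; exact: measurableT_comp.
have D0 w : 0 < 1 + `|alpha w| by rewrite ltr_pwDl.
have b0 w : 0 < b w by rewrite invr_gt0.
have b1 w : b w <= 1 by rewrite invf_le1// lerDl.
have ab1 : {ae P, forall w, alpha w * b w <= 1}.
  apply: filterS alpha_pp => w a0; rewrite ler_pdivrMr// mul1r gtr0_norm//.
  by rewrite lerDr.
have n0 n : 0 < n.+1%:R^-1 :> R by rewrite invr_gt0.
have /choice[s hs] (xn : E * nat) : exists y, ekeland_le y xn.1 /\
    forall u, ekeland_le u xn.1 -> {ae P, forall w,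
      (f y w <= f u w + (xn.2.+1%:R^-1 * (alpha w * b w))%:E)%E}.
  have [||y yx yinf] :=
    @ekeland_near_inf xn.1 (fun w => xn.2.+1%:R^-1 * (alpha w * b w)).
  - by apply: measurable_funM => //; exact: measurable_funM.
  - by apply: filterS alpha_pp => w a0; rewrite !mulr_gt0.
  by exists y.
pose x := fix x n := if n is n'.+1 then s (x n', n') else x0.
have xmono n m : (n <= m)%N -> ekeland_le (x m) (x n).
  elim: m => [|m IH]; first by rewrite leqn0 => /eqP ->; exact: ekeland_le_refl.
  rewrite leq_eqVlt => /predU1P[->|]; first exact: ekeland_le_refl.
  rewrite ltnS => /IH; apply: ekeland_le_trans; exact: (hs (x m, m)).1.
have ffin n : {ae P, forall w, f (x n) w \is a fin_num}.
  apply: filterS3 (bounded_from_below_ae (x n)) fx0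
    (ekeland_le_value _ _ (xmono 0%N n isT)) => w h1 h2 h3.
  by rewrite fin_numE gt_eqF// lt_eqF// (le_lt_trans h3).
have xclose n u : ekeland_le u (x n.+1) ->
    {ae P, forall w, rm_dist u (x n.+1) w <= n.+1%:R^-1 * b w}.
  move=> ux.
  have uxn := ekeland_le_trans _ _ _ ux (hs (x n, n)).1.
  near=> w.
  have a0 : 0 < alpha w by exact: (near alpha_pp w).
  rewrite -(ler_pM2l a0) [leRHS]mulrCA -lee_fin.
  have xfin : f (x n.+1) w \is a fin_num by exact: (near (ffin n.+1) w).
  have h1 : (f u w + (alpha w * rm_dist u (x n.+1) w)%:E <= f (x n.+1) w)%E.
    exact: (near ux w).
  have h2 : (f (x n.+1) w <= f u w + (n.+1%:R^-1 * (alpha w * b w))%:E)%E.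
    exact: (near ((hs (x n, n)).2 u uxn) w).
  have := le_trans h1 h2; rewrite leeD2lE// fin_numE.
  apply/andP; split.
    by apply/eqP => fu; move: h2 xfin; rewrite fu addNye leeNy_eq => /eqP ->.
  by apply/eqP => fu; move: h1 xfin; rewrite fu addye// leye_eq => /eqP ->.
have [z xz] : exists z : E, x n.+1 @[n --> \oo] --> z.
  apply: (@el_complete_ae_cauchy E (fun n => x n.+1) (fun n => n.+1%:R^-1)) => //.
    exact: cvg_harmonic.
  move=> n m nm; apply: filterS (xclose n _ (xmono n.+1 m.+1 nm)) => w.
  by move/le_trans; apply; rewrite ler_piMr// ltW.
have zclose n : {ae P, forall w, rm_dist z (x n.+1) w <= n.+1%:R^-1 * b w}.
  apply: (@rm_dist_limit_ae_le E _ z (x n.+1) _ _ xz).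
    exact: measurable_funM.
  exists n => // m /= nm; exact: xclose (xmono n.+1 m.+1 nm).
have zx n : ekeland_le z (x n).
  have mr : measurable_fun setT
      (fun w => fine (f (x n) w) - alpha w * rm_dist z (x n) w).
    apply: measurable_funB; last by apply: measurable_funM; exact: measurable_L0.
    exact: measurableT_comp (measurable_L0bar (f (x n))).
  (* The claim reads [f z <= r], and [f (x k.+1) <= r + 1 / (k+1)] because
     [alpha d(z, x n)] exceeds [alpha d(x k.+1, x n)] by at most 1 / (k+1). *)
  pose r := L0_class P mr.
  have rE : {ae P, forall w, r w = fine (f (x n) w) - alpha w * rm_dist z (x n) w}.
    exact: L0_classE.
  have fzr : {ae P, forall w, (f z w <= (r w)%:E)%E}.
    apply: lsc_ae_le_limit => // e e0.
    have [k0 _ hk0] := near_infty_natSinv_lt (PosNum e0).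
    pose k := maxn n k0.
    have ke : k.+1%:R^-1 <= e by apply/ltW/hk0; exact: leq_maxr.
    have kn : ekeland_le (x k.+1) (x n) by apply: xmono; rewrite leqW// leq_maxl.
    exists (x k.+1); split.
      apply: filterS (zclose k) => w /le_trans; apply.
      by apply: le_trans ke; rewrite ler_piMr// ltW.
    near=> w.
    have a0 : 0 < alpha w by exact: (near alpha_pp w).
    have xfin : f (x n) w \is a fin_num by exact: (near (ffin n) w).
    have kfin : f (x k.+1) w \is a fin_num by exact: (near (ffin k.+1) w).
    have h1 : (f (x k.+1) w + (alpha w * rm_dist (x k.+1) (x n) w)%:E
      <= f (x n) w)%E by exact: (near kn w).
    move: h1.
    rewrite (near rE w)// -(fineK xfin) -(fineK kfin) -EFinD !lee_fin.
    move=> h1.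
    have h2 : rm_dist z (x n) w <= rm_dist z (x k.+1) w + rm_dist (x k.+1) (x n) w.
      exact: (near (rm_dist_triangle_ae E z (x k.+1) (x n)) w).
    have h3 : alpha w * rm_dist z (x k.+1) w <= e.
      apply: le_trans ke; apply: (@le_trans _ _ (alpha w * (k.+1%:R^-1 * b w))).
        by rewrite ler_pM2l//; exact: (near (zclose k) w).
      by rewrite mulrCA ler_piMr ?(ltW (n0 k))//; exact: (near ab1 w).
    have : alpha w * rm_dist z (x n) w <=
        alpha w * rm_dist z (x k.+1) w + alpha w * rm_dist (x k.+1) (x n) w.
      by rewrite -mulrDr ler_pM2l.
    lra.
  apply: filterS3 fzr rE (ffin n) => w /[swap] -> + xfin.
  by rewrite EFinB fineK// leeBrDr.
exists z => [|y yz]; first exact: zx 0%N.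
apply: rm_dist_eq0_ae.
have small (n : nat) : {ae P, forall w, rm_dist y z w <= 2 * n.+1%:R^-1}.
  have yx := ekeland_le_trans _ _ _ yz (zx n.+1).
  near=> w.
  have h : rm_dist y z w <= rm_dist y (x n.+1) w + rm_dist (x n.+1) z w.
    exact: (near (rm_dist_triangle_ae E y (x n.+1) z) w).
  have h1 : rm_dist y (x n.+1) w <= n.+1%:R^-1 * b w by exact: (near (xclose n y yx) w).
  have h2 : rm_dist z (x n.+1) w <= n.+1%:R^-1 * b w by exact: (near (zclose n) w).
  have h3 : n.+1%:R^-1 * b w <= n.+1%:R^-1 by rewrite ler_piMr// ltW.
  rewrite mulr_natl mulr2n (le_trans h)// lerD//; first exact: le_trans h3.
  by rewrite rm_dist_sym (le_trans h2).
apply: filterS2 (ae_foralln small) (rm_dist_ge0_ae y z) => w h h0.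
apply/eqP; rewrite eq_le h0 andbT leNgt; apply/negP => yz0.
have yz2 : 0 < rm_dist y z w / 2 by rewrite divr_gt0.
have [k _ /(_ k (leqnn k)) hk] := near_infty_natSinv_lt (PosNum yz2).
have {}hk : k.+1%:R^-1 < rm_dist y z w / 2 := hk.
by move: hk; rewrite ltr_pdivlMr// mulrC => /lt_le_trans/(_ (h k)); rewrite ltxx.
Unshelve. all: by end_near. Qed.

(** Minimality localizes: an event of positive probability on which [x] beats [z]
    would give, by gluing, a point other than [z] below [z]. *)
Lemma ekeland_minimal_ae_ge (z x : E) : (forall y, ekeland_le y z -> y = z) ->
  {ae P, forall w, (f z w - (alpha w * rm_dist x z w)%:E <= f x w)%E}.
Proof.
move=> z_min.
pose g w := (f x w + (alpha w * rm_dist x z w)%:E)%E.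
have mg : measurable_fun setT g.
  apply: emeasurable_funD; first exact: measurable_L0bar (f x).
  by apply/measurable_EFinP/measurable_funM; exact: measurable_L0.
pose A := [set w | (f z w <= g w)%E].
have mA : measurable A.
  rewrite -[A]setTI; apply: measurable_lee => //.
pose F k := if k is 0%N then ~` A else A.
have mF k : measurable (F k) by case: k => [|k] //; exact: measurableC.
have cF : \bigcup_k F k = setT.
  apply/seteqP; split=> // w _.
  by have [Aw|nA] := pselect (A w); [exists 1%N|exists 0%N].
have [y hy] :=
  glue_cover E f F (fun k => if k is 0%N then x else z) E_stable f_stable mF cF.
have yz : y = z.
  apply: z_min; apply: filterS2 (hy z) (rm_distxx_ae E z).
  move=> w [[|k] [Fk -> ->] zz0]; last by rewrite zz0 mulr0 adde0.
  by apply: ltW; rewrite ltNge; apply/negP.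
have := hy z; rewrite yz.
apply: filterS2 (rm_distxx_ae E z) => w zz0 [[|k] [Fk fE dE]].
  by exfalso; apply: Fk; rewrite /A/= /g -dE fE zz0 mulr0 adde0.
by rewrite leeBlDr.
Qed.

End Ekeland.
End RandomMetric.

(** * The random Ekeland variational principle *)

Theorem theorem3p6 (d : measure_display) (T : measurableType d) (R : realType)
    (P : probability T R) (E : RMspace P)
    (E_stable : d_sigma_stable E) (E_complete : el_complete E)
    (eps : L0 P) (eps_pp : L0_pp eps)
    (f : E -> L0bar P) (f_proper : proper_fun f) (f_stable : sigma_stable_fun f)
    (f_lsc : el_lsc f) (f_bounded : bounded_from_below f)
    (x0 : E) (hx0 : f x0 <= L0bar_add (L0bar_inf (range f)) (L0_EFin eps))
    (alpha : L0 P) (alpha_pp : L0_pp alpha) :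
  exists z : E,
    [/\ f z <= L0bar_sub (f x0) (L0_EFin (alpha * rm_dist z x0)),
        rm_dist z x0 <= L0_inv alpha * eps &
        forall x : E, x <> z ->
          L0bar_sub (f z) (L0_EFin (alpha * rm_dist x z)) <= f x /\
          f x <> L0bar_sub (f z) (L0_EFin (alpha * rm_dist x z))].
Proof.
(* The infimum enters only through [f x0 <= f p + eps] for all [p]. *)
have fx0_le p : {ae P, forall w, (f x0 w <= f p w + (eps w)%:E)%E}.
  have range0 : range f !=set0 by exists (f p), p.
  have /L0bar_leP inf_le : L0bar_inf (range f) <= f p.
    by apply: (L0bar_infP range0).1; exists p.
  have /L0bar_leP x0_le := hx0.
  near=> w; have : (f x0 w <= L0bar_add (L0bar_inf (range f)) (L0_EFin eps) w)%E.
    exact: (near x0_le w).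
  have -> : L0bar_add (L0bar_inf (range f)) (L0_EFin eps) w =
      (L0bar_inf (range f) w + (eps w)%:E)%E.
    rewrite -(near (L0_EFinE eps) w)//.
    by rewrite (near (L0bar_classE P (emeasurable_funD (measurable_L0bar
      (L0bar_inf (range f))) (measurable_L0bar (L0_EFin eps)))) w).
  by move=> /le_trans; apply; rewrite leeD2r//; exact: (near inf_le w).
have fx0_fin : {ae P, forall w, (f x0 w < +oo)%E}.
  have [_ [p fp]] := f_proper.
  apply: filterS2 (fx0_le p) fp => w /le_lt_trans h fpw; apply: h.
  by rewrite lte_add_pinfty// ltry.
have [z zx0 z_min] := ekeland_minimal_point
  f alpha alpha_pp E_stable f_stable f_bounded x0 E_complete f_lsc fx0_fin.
have subE u v : {ae P, forall w, L0bar_sub (f u) (L0_EFin (alpha * rm_dist v u)) w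
    = (f u w - (alpha w * rm_dist v u w)%:E)%E}.
  near=> w.
  rewrite -(near (L0ME alpha (rm_dist v u)) w)//.
  rewrite -(near (L0_EFinE (alpha * rm_dist v u)) w)//.
  by rewrite (near (L0bar_classE P (emeasurable_funB (measurable_L0bar (f u))
    (measurable_L0bar (L0_EFin (alpha * rm_dist v u))))) w).
exists z; split.
- apply/L0bar_leP; apply: filterS2 (subE x0 z) zx0 => w ->.
  by rewrite leeBrDr.
- apply/L0_leP; near=> w.
  rewrite (near (L0ME (L0_inv alpha) eps) w)//.
  rewrite (near (L0_classE P (measurableT_comp (@measurable_inv R)
    (measurable_L0 alpha))) w)//=.
  have a0 : 0 < alpha w by exact: (near alpha_pp w).
  rewrite ler_pdivlMl// -lee_fin.
  have h1 : (f z w + (alpha w * rm_dist z x0 w)%:E <= f x0 w)%E.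
    exact: (near zx0 w).
  have h2 : (f x0 w <= f z w + (eps w)%:E)%E by exact: (near (fx0_le z) w).
  have fz : f z w \is a fin_num.
    rewrite fin_numE gt_eqF ?(near (f_proper.1 z) w)//= lt_eqF//.
    apply: le_lt_trans (near fx0_fin w _) => //.
    exact: (near (ekeland_le_value _ _ alpha_pp _ _ zx0) w).
  by have := le_trans h1 h2; rewrite leeD2lE.
- move=> x xz; split.
    apply/L0bar_leP; apply: filterS2 (subE z x)
      (ekeland_minimal_ae_ge f alpha E_stable f_stable z x z_min) => w ->.
    by [].
  move=> fx; apply/xz/z_min; have := subE z x; rewrite -fx.
  apply: filterS => w ->.
  by rewrite subeK.
Unshelve. all: by end_near. Qed.
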